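(* Let $n \geq 2$ be an integer. Then there exist $\varepsilon_n > 0$ and a function $K_n : [0, \varepsilon_n) \to \mathbb{R}$ with $$K_n(\varepsilon) = 1 + (18n^2 - 17n + 14)\varepsilon + O(\varepsilon^2) \quad \text{as } \varepsilon \to 0^+$$ (both depending only on $n$) such that for every $n$-dimensional real normed vector space $X$ whose von Neumann-Jordan constant equals $\varepsilon + 1$ with $\varepsilon < \varepsilon_n$, one has $d(X, \mathbb{R}^n) \leq K_n(\varepsilon)$.
   Context: The von Neumann-Jordan constant of a real normed vector space $X$ is the smallest $M \in [1,2]$ such that $\frac{1}{M} \le \frac{\|a+b\|^2 + \|a-b\|^2}{2(\|a\|^2 + \|b\|^2)} \le M$ for all nonzero $a, b \in X$. $\mathbb{R}^n$ carries the Euclidean norm, i.e. $\mathbb{R}^n = \ell_2^n$. For two normed vector spaces $X$ and $Y$ over the same field with the same finite dimension, the Banach-Mazur distance is $d(X,Y) = \inf\{\|\Lambda\| \cdot \|\Lambda^{-1}\| : \Lambda : X \to Y \text{ is a linear isomorphism}\} \geq 1$, with operator norms. *)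

(* Defs.v *)
From HB Require Import structures.
From mathcomp Require Import all_boot all_order all_algebra.
From mathcomp Require Import all_classical all_reals all_analysis.
From mathcomp Require Import ring lra.

Set Implicit Arguments.
Unset Strict Implicit.
Unset Printing Implicit Defensive.

Import Order.TTheory GRing.Theory Num.Theory.
Import numFieldNormedType.Exports.

Local Open Scope classical_set_scope.
Local Open Scope ring_scope.

#[short(type="normedVectType")]
HB.structure Definition NormedVector (R : numFieldType) :=
  {V of NormedModule R V & Vector R V}.

(* An alias is needed because the library norms 'rV[R]_n by the maximum of
   the absolute values of the entries. *)
Definition euclidean (R : realType) (n : nat) : Type := 'rV[R]_n.

Section Euclidean.
Variables (R : realType) (n : nat).

HB.instance Definition _ := Vector.copy (euclidean R n) 'rV[R]_n.

Definition eucl_norm (x : euclidean R n) : R :=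
  Num.sqrt (\sum_(i < n) x ord0 i ^+ 2).

Let sumsq_ge0 (x : euclidean R n) : 0 <= \sum_(i < n) x ord0 i ^+ 2.
Proof. by apply: sumr_ge0 => i _; exact: sqr_ge0. Qed.

Lemma sqr_eucl_norm x : eucl_norm x ^+ 2 = \sum_(i < n) x ord0 i ^+ 2.
Proof. by rewrite sqr_sqrtr. Qed.

Lemma eucl_norm_eq0 x : eucl_norm x = 0 -> x = 0.
Proof.
move=> x0; have /eqP := sqr_eucl_norm x; rewrite x0 expr0n /= eq_sym.
rewrite psumr_eq0 => [/allP h|i _]; last exact: sqr_ge0.
apply/rowP => i; rewrite mxE; apply/eqP.
by have := h i (mem_index_enum i); rewrite /= sqrf_eq0.
Qed.

Lemma eucl_normZ (l : R) x : eucl_norm (l *: x) = `|l| * eucl_norm x.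
Proof.
rewrite /eucl_norm -sqrtr_sqr -sqrtrM ?sqr_ge0// mulr_sumr.
by congr Num.sqrt; apply: eq_bigr => i _; rewrite mxE exprMn.
Qed.

Lemma eucl_CauchySchwarz (x y : euclidean R n) :
  \sum_(i < n) x ord0 i * y ord0 i <= eucl_norm x * eucl_norm y.
Proof.
have [/eucl_norm_eq0 ->|x0] := eqVneq (eucl_norm x) 0.
  rewrite big1 => [|i _]; last by rewrite mxE mul0r.
  by rewrite mulr_ge0 ?sqrtr_ge0.
have [/eucl_norm_eq0 ->|y0] := eqVneq (eucl_norm y) 0.
  rewrite big1 => [|i _]; last by rewrite mxE mulr0.
  by rewrite mulr_ge0 ?sqrtr_ge0.
have xp : 0 < eucl_norm x by rewrite lt0r x0 sqrtr_ge0.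
have yp : 0 < eucl_norm y by rewrite lt0r y0 sqrtr_ge0.
set a := eucl_norm x in xp *; set b := eucl_norm y in yp *.
set s := \sum_(i < n) _.
have : 0 <= \sum_(i < n) (b * x ord0 i - a * y ord0 i) ^+ 2.
  by apply: sumr_ge0 => i _; exact: sqr_ge0.
have -> : \sum_(i < n) (b * x ord0 i - a * y ord0 i) ^+ 2
    = (a * b) * (2 * (a * b - s)).
  transitivity (b ^+ 2 * (\sum_(i < n) x ord0 i ^+ 2)
      + a ^+ 2 * (\sum_(i < n) y ord0 i ^+ 2) - 2 * a * b * s); last first.
    by rewrite -!sqr_eucl_norm -/a -/b; ring.
  rewrite /s !mulr_sumr -big_split /= -sumrB.
  by apply: eq_bigr => i _; ring.
by rewrite pmulr_rge0 ?mulr_gt0// pmulr_rge0// subr_ge0.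
Qed.

Lemma eucl_normD x y : eucl_norm (x + y) <= eucl_norm x + eucl_norm y.
Proof.
rewrite -(ler_pXn2r (n := 2))// ?nnegrE ?addr_ge0 ?sqrtr_ge0//.
rewrite sqrrD !sqr_eucl_norm.
have -> : \sum_(i < n) (x + y) ord0 i ^+ 2 = \sum_(i < n) x ord0 i ^+ 2 +
    (\sum_(i < n) x ord0 i * y ord0 i) *+ 2 + \sum_(i < n) y ord0 i ^+ 2.
  by rewrite -sumrMnl -!big_split /=; apply: eq_bigr => i _; rewrite mxE sqrrD.
by rewrite lerD2r lerD2l lerMn2r eucl_CauchySchwarz orbT.
Qed.

HB.instance Definition _ := Lmodule_isNormed.Build R (euclidean R n)
  eucl_normD eucl_normZ eucl_norm_eq0.

End Euclidean.

Section Definitions.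
Variable R : realType.

Definition vNJ_bound (X : normedModType R) : set R :=
  [set M | 1 <= M <= 2 /\ forall a b : X, a != 0 -> b != 0 ->
    1 / M <= (`|a + b| ^+ 2 + `|a - b| ^+ 2) / (2 * (`|a| ^+ 2 + `|b| ^+ 2))
          <= M].

Definition is_vNJ_constant (X : normedModType R) (C : R) : Prop :=
  vNJ_bound X C /\ lbound (vNJ_bound X) C.

(* The operator norm and the Banach-Mazur distance are extended reals, so that
   neither an unbounded operator nor an empty set of isomorphisms produces a
   default value; between spaces of the same finite dimension both are real. *)
Definition op_norm (X Y : normedModType R) (f : {linear X -> Y}) : \bar R :=
  ereal_sup [set `|f x|%:E | x in [set x : X | `|x| <= 1]].

Definition banach_mazur (X Y : normedModType R) : \bar R :=
  ereal_inf [set c | exists (L : {linear X -> Y}) (Li : {linear Y -> X}),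
    [/\ cancel L Li, cancel Li L & c = (op_norm L * op_norm Li)%E]].

End Definitions.

(* Main.v *)
Require Import Defs.
From mathcomp Require Import all_boot all_order all_algebra perm.
From mathcomp Require Import all_classical all_reals all_analysis.
From mathcomp Require Import ring lra.

(* In coordinates given by a basis, N(x) = |x|^2 satisfies the parallelogram law
   up to an error 2 e (N(a) + N(b)).  Let S be the quadratic form whose matrix is
   obtained from N by polarisation on the basis vectors.  Then D = N - S is
   homogeneous of degree 2 and still approximately quadratic; a halving argument
   controls D on coordinate planes, and approximate additivity of
   D(x + z) - D(x) - D(z) propagates this to |D(x)| <= 6 n^2 B e sum x_i^2 when
   N(x) <= B sum x_i^2.  If also sum x_i^2 <= A N(x), a basis orthonormal for S
   gives an isomorphism with R^n of squared distortion
   (1 + eta) / (1 - eta), eta = 6 n^2 A B e.  The first basis, of nearly maximal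
   determinant in the unit ball, has A = 4n and B = n^2; the basis it yields has
   A = 9/8 and B = 8/7 for small e, and a second application gives
   eta = (54/7) n^2 e, which leaves room below the stated constant. *)

Set Implicit Arguments.
Unset Strict Implicit.
Unset Printing Implicit Defensive.

Import Order.TTheory GRing.Theory Num.Theory.
Import numFieldNormedType.Exports VectorInternalTheory.
Local Open Scope classical_set_scope.
Local Open Scope ring_scope.

(** * Bilinear forms given by matrices *)

Definition bform {R : comNzRingType} {n : nat} (S : 'M[R]_n) (x y : 'rV[R]_n) : R :=
  (x *m S *m y^T) 0 0.

(** Written as a [bform] so that the bilinearity lemmas apply; orthogonality is
    [bform 1%:M x y = 0]. *)
Definition sqnorm {R : comNzRingType} {n : nat} (x : 'rV[R]_n) : R := bform 1%:M x x.

Lemma bformDl (R : comNzRingType) n (S : 'M[R]_n) x y z :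
  bform S (x + y) z = bform S x z + bform S y z.
Proof. by rewrite /bform !mulmxDl mxE. Qed.

Lemma bformDr (R : comNzRingType) n (S : 'M[R]_n) x y z :
  bform S z (x + y) = bform S z x + bform S z y.
Proof. by rewrite /bform linearD mulmxDr mxE. Qed.

Lemma bformZl (R : comNzRingType) n (S : 'M[R]_n) t x y :
  bform S (t *: x) y = t * bform S x y.
Proof. by rewrite /bform -!scalemxAl mxE. Qed.

Lemma bformZr (R : comNzRingType) n (S : 'M[R]_n) t x y :
  bform S x (t *: y) = t * bform S x y.
Proof. by rewrite /bform linearZ /= -scalemxAr mxE. Qed.

Lemma bformNr (R : comNzRingType) n (S : 'M[R]_n) x y :
  bform S x (- y) = - bform S x y.
Proof. by rewrite -scaleN1r bformZr mulN1r. Qed.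

Lemma bformNl (R : comNzRingType) n (S : 'M[R]_n) x y :
  bform S (- x) y = - bform S x y.
Proof. by rewrite -scaleN1r bformZl mulN1r. Qed.

Lemma bformC (R : comNzRingType) n (S : 'M[R]_n) x y :
  S^T = S -> bform S x y = bform S y x.
Proof.
move=> sS; rewrite /bform -[in RHS]sS.
by rewrite -[RHS](mxE trmx_key (fun i j => (y *m S^T *m x^T) j i)) -/(trmx _)
  !trmx_mul !trmxK mulmxA.
Qed.

Lemma bform_delta (R : comNzRingType) n (S : 'M[R]_n) i j :
  bform S (delta_mx 0 i) (delta_mx 0 j) = S i j.
Proof. by rewrite /bform trmx_delta -rowE -colE !mxE. Qed.

Lemma bform_congr (R : comNzRingType) n (T S : 'M[R]_n) x y :
  bform S (x *m T) (y *m T) = bform (T *m S *m T^T) x y.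
Proof. by rewrite /bform trmx_mul !mulmxA. Qed.

Lemma sqnormE (R : comNzRingType) n (x : 'rV[R]_n) :
  sqnorm x = \sum_(i < n) x 0 i ^+ 2.
Proof.
by rewrite /sqnorm /bform mulmx1 mxE; apply: eq_bigr => i _; rewrite mxE expr2.
Qed.

Lemma sqnorm_ge0 (R : realDomainType) n (x : 'rV[R]_n) : 0 <= sqnorm x.
Proof. by rewrite sqnormE sumr_ge0// => i _; exact: sqr_ge0. Qed.

Lemma sqnormD (R : comNzRingType) n (x y : 'rV[R]_n) :
  sqnorm (x + y) = sqnorm x + sqnorm y + 2 * bform 1%:M x y.
Proof.
rewrite /sqnorm !bformDl !bformDr (@bformC _ _ _ y x) ?trmx1//; ring.
Qed.

Lemma sqnormZ (R : comNzRingType) n t (x : 'rV[R]_n) :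
  sqnorm (t *: x) = t ^+ 2 * sqnorm x.
Proof. by rewrite /sqnorm bformZl bformZr mulrA expr2. Qed.

(** * Approximately quadratic functions on planes *)

(* The supremum M of |G| satisfies M <= (M + c) / 2. *)
Lemma halving_bound (R : realType) (T : Type) (P : T -> Prop) (G : T -> R) (K c : R) :
  (forall t, P t -> `|G t| <= K) ->
  (forall M : R, (forall t, P t -> `|G t| <= M) ->
     forall t, P t -> 2 * `|G t| <= M + c) ->
  forall t, P t -> `|G t| <= c.
Proof.
move=> GK Ghalf t Pt.
pose A : set R := [set `|G u| | u in [set u | P u]].
have A0 : A !=set0 by exists `|G t|, t.
have Asup u : P u -> `|G u| <= sup A.
  move=> Pu; apply: ub_le_sup; last by exists u.
  by exists K => _ [v Pv <-]; exact: GK.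
have : sup A <= (sup A + c) / 2.
  apply: ge_sup => // _ [u Pu <-]; have := Ghalf _ Asup u Pu; lra.
have := Asup t Pt; lra.
Qed.

(** The error is measured by [sqnorm] rather than by [D], so the condition survives subtracting a
    quadratic form from [D]. *)
Definition approx_quadratic {R : realType} {n : nat} (d : R) (D : 'rV[R]_n -> R) :=
  (forall (t : R) (x : 'rV_n), D (t *: x) = t ^+ 2 * D x) /\
  (forall a b : 'rV_n, `|D (a + b) + D (a - b) - 2 * D a - 2 * D b|
     <= d * (sqnorm a + sqnorm b)).

(** The parallelogram law at [e + t *: f], with second vector along [f], bounds 2 |D(e + t f)| by
    the value at another point of the segment plus a multiple of d; [halving_bound] then applies.
    [K] only makes the supremum finite. *)
Lemma approx_quadratic_plane (R : realType) n (d K : R) (D : 'rV[R]_n -> R) e f :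
  approx_quadratic d D ->
  sqnorm e = 1 -> sqnorm f = 1 -> bform 1%:M e f = 0 ->
  D e = 0 -> D f = 0 -> D (e + f) = D (e - f) ->
  (forall t : R, `|t| <= 1 -> `|D (e + t *: f)| <= K) ->
  forall t : R, `|t| <= 1 -> `|D (e + t *: f)| <= 3 * d.
Proof.
move=> [DZ Dpar] se sf ef De Df Def DK.
have sq s : sqnorm (e + s *: f) = 1 + s ^+ 2.
  by rewrite sqnormD sqnormZ bformZr se sf ef; ring.
have d0 : 0 <= d.
  have := le_trans (normr_ge0 _) (Dpar e f); rewrite se sf; lra.
have Dpm : `|D (e + f)| <= d.
  have := Dpar e f; rewrite -Def De Df se sf.
  by rewrite !ler_norml => /andP[? ?]; apply/andP; split; lra.
apply: (@halving_bound R R (fun t : R => `|t| <= 1) (fun t => D (e + t *: f)) K) => //.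
move=> M DM t t1.
(* If |2t| <= 1, use the second vector t f: the points reached are e + 2t f, still on the segment,
   and e, where D vanishes. The error factor is 1 + 2 t^2 <= 3/2. *)
have [small|big] := leP `|2 * t| 1.
  have t2 : t + t = 2 * t by ring.
  have := Dpar (e + t *: f) (t *: f).
  rewrite addrK -(addrA e) -scalerDl t2 De DZ Df sq sqnormZ sf.
  have := DM _ small; move: small.
  rewrite !ler_norml => /andP[? ?] /andP[? ?] /andP[? ?].
  have : t ^+ 2 <= 1 / 4 by nra.
  move=> t4; have : d * (1 + t ^+ 2 + t ^+ 2 * 1) <= d * (3/2) by nra.
  move=> ?; suff : `|D (e + t *: f)| <= (M + 3 * d) / 2 by lra.
  by rewrite ler_norml; apply/andP; split; lra.
(* Changing the signs of t and f together leaves t f unchanged. *)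
wlog t0 : f t t1 big sf ef Df Def Dpm DK DM sq / 0 <= t => [hw|].
  have [t0|t0] := leP 0 t; first exact: hw.
  have E : (- t) *: (- f) = t *: f by rewrite scalerN scaleNr opprK.
  rewrite -E; apply: hw.
  - by rewrite normrN.
  - by rewrite mulrN normrN.
  - by rewrite -scaleN1r sqnormZ sf; ring.
  - by rewrite bformNr ef oppr0.
  - by rewrite -scaleN1r DZ Df mulr0.
  - by rewrite opprK.
  - by rewrite -Def.
  - by move=> s s1; rewrite scalerN -scaleNr; apply: DK; rewrite normrN.
  - by move=> s s1; rewrite scalerN -scaleNr; apply: DM; rewrite normrN.
  - by move=> s; rewrite scalerN -scaleNr sq sqrrN.
  - by rewrite oppr_ge0 ltW.
rewrite ger0_norm // in t1; rewrite ger0_norm ?mulr_ge0 // in big.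
(* The points reached are e + f, where |D| <= d, and e + (2t - 1) f. The error is at most 2d, so the
   total d + 2d is the constant 3d. *)
have := Dpar (e + t *: f) ((1 - t) *: f).
rewrite -!(addrA e) -scalerDl -scalerBl (addrC t) subrK scale1r DZ Df sq sqnormZ sf.
have /DM : `|t - (1 - t)| <= 1 by rewrite ler_norml; apply/andP; split; lra.
move: Dpm; rewrite !ler_norml => /andP[? ?] /andP[? ?].
have : d * (1 + t ^+ 2 + (1 - t) ^+ 2 * 1) <= d * 2 by rewrite ler_wpM2l //; nra.
move=> ? /andP[? ?].
suff : `|D (e + t *: f)| <= (M + 3 * d) / 2 by lra.
by rewrite ler_norml; apply/andP; split; lra.
Qed.

(** By homogeneity, divide by the coordinate of larger absolute value. *)
Lemma approx_quadratic_span (R : realType) n (d c : R) (D : 'rV[R]_n -> R) e f :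
  (forall (t : R) (x : 'rV_n), D (t *: x) = t ^+ 2 * D x) ->
  (forall t : R, `|t| <= 1 -> `|D (e + t *: f)| <= c) ->
  (forall t : R, `|t| <= 1 -> `|D (f + t *: e)| <= c) ->
  forall s t : R, `|D (s *: e + t *: f)| <= c * (s ^+ 2 + t ^+ 2).
Proof.
move=> DZ De Df s t; have c0 : 0 <= c.
  by apply: le_trans (De 0 _); rewrite ?normr0.
wlog st : s t e f De Df / `|t| <= `|s| => [hw|].
  have [|/ltW] := leP `|t| `|s|; first exact: hw.
  by move=> st; rewrite addrC [s ^+ 2 + _]addrC; exact: hw.
have [s0|s0] := eqVneq s 0.
  move: st; rewrite s0 normr0 normr_le0 => /eqP ->.
  by rewrite !scale0r addr0 -(scale0r e) DZ expr0n mul0r normr0 addr0 mulr0.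
have -> : s *: e + t *: f = s *: (e + (t / s) *: f).
  by rewrite scalerDr scalerA mulrCA divff// mulr1.
rewrite DZ normrM ger0_norm ?sqr_ge0//.
apply: (@le_trans _ _ (s ^+ 2 * c)); last by have := mulr_ge0 c0 (sqr_ge0 t); lra.
rewrite ler_wpM2l ?sqr_ge0// De//.
by rewrite normrM normfV ler_pdivrMr ?normr_gt0// mul1r.
Qed.

(* The parallelogram law at x + z/2, y + z/2 turns D(x + y + z) into terms
   involving at most two of the three vectors. *)
Lemma approx_quadratic_triple (R : realType) n (d : R) (D : 'rV[R]_n -> R) x y z :
  approx_quadratic d D ->
  bform 1%:M x y = 0 -> bform 1%:M x z = 0 -> bform 1%:M y z = 0 ->
  `|D (x + y + z) - D (x + y) - D (x + z) - D (y + z) + D x + D y + D z|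
    <= 3 * d * (sqnorm x + sqnorm y + sqnorm z).
Proof.
move=> [DZ Dpar] xy xz yz.
have h2 : (2^-1 + 2^-1 = 1 :> R) by field.
have half (u : 'rV[R]_n) : u + z = u + 2^-1 *: z + 2^-1 *: z.
  by rewrite -addrA -scalerDl h2 scale1r.
have Eplus : x + 2^-1 *: z + (y + 2^-1 *: z) = x + y + z.
  by rewrite addrACA -scalerDl h2 scale1r.
have Eminus : x + 2^-1 *: z - (y + 2^-1 *: z) = x - y.
  by rewrite opprD addrACA subrr addr0.
have sqh u : bform 1%:M u z = 0 -> sqnorm (u + 2^-1 *: z) = sqnorm u + sqnorm z / 4.
  by move=> uz; rewrite sqnormD sqnormZ bformZr uz; field.
have d0 : 0 <= d * (sqnorm z + sqnorm z).
  exact: le_trans (normr_ge0 _) (Dpar z z).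
(* The first instance minus the other three is the expression to bound: D(x - y) and the values at x
   + z/2 and y + z/2 cancel. With |u|^2 for [sqnorm u], the errors add up to d (3 |x|^2 + 3 |y|^2 +
   3/2 |z|^2). *)
have := Dpar (x + 2^-1 *: z) (y + 2^-1 *: z).
have := Dpar (x + 2^-1 *: z) (2^-1 *: z).
have := Dpar (y + 2^-1 *: z) (2^-1 *: z).
have := Dpar x y.
rewrite Eplus Eminus -!half !addrK !sqh// DZ sqnormZ.
rewrite !ler_norml => /andP[? ?] /andP[? ?] /andP[? ?] /andP[? ?].
by apply/andP; split; lra.
Qed.

(** * From coordinate planes to the whole space *)

Definition prefix_row {R : nmodType} {n : nat} (k : nat) (x : 'rV[R]_n) : 'rV[R]_n :=
  \row_i (if (i < k)%N then x 0 i else 0).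

Lemma prefix_row0 (R : nmodType) n (x : 'rV[R]_n) : prefix_row 0 x = 0.
Proof. by apply/rowP => i; rewrite !mxE. Qed.

Lemma prefix_row_size (R : nmodType) n (x : 'rV[R]_n) : prefix_row n x = x.
Proof. by apply/rowP => i; rewrite mxE ltn_ord. Qed.

Lemma prefix_rowS (R : pzRingType) n (i : 'I_n) (x : 'rV[R]_n) :
  prefix_row i.+1 x = prefix_row i x + x 0 i *: delta_mx 0 i.
Proof.
apply/rowP => j; rewrite !mxE /= ltnS leq_eqVlt (inj_eq val_inj) eq_sym.
have [->|] := eqVneq j i; first by rewrite ltnn mulr1 add0r.
by rewrite mulr0 addr0.
Qed.

Lemma bform_prefix_row (R : comNzRingType) n k (i : 'I_n) (x : 'rV[R]_n) t :
  (k <= i)%N -> bform 1%:M (prefix_row k x) (t *: delta_mx 0 i) = 0.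
Proof.
move=> ki; rewrite bformZr /bform mulmx1 trmx_delta -colE !mxE ltnNge ki.
by rewrite mulr0.
Qed.

Lemma sqnorm_delta (R : comNzRingType) n (i : 'I_n) :
  sqnorm (delta_mx 0 i : 'rV[R]_n) = 1.
Proof. by rewrite /sqnorm bform_delta mxE eqxx. Qed.

Lemma sqnorm_prefix_row (R : realDomainType) n k (i : 'I_n) (x : 'rV[R]_n) :
  (k <= i)%N -> sqnorm (prefix_row k x) + x 0 i ^+ 2 <= sqnorm x.
Proof.
move=> ki; rewrite !sqnormE (bigD1 i)//= [leRHS](bigD1 i)//= mxE ltnNge ki/=.
rewrite expr2 mul0r add0r [leLHS]addrC lerD2l ler_sum// => j _; rewrite mxE.
by case: ifP => // _; rewrite expr2 mul0r sqr_ge0.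
Qed.

Lemma sqnorm_coord2 (R : realDomainType) n (i j : 'I_n) (x : 'rV[R]_n) :
  i != j -> x 0 i ^+ 2 + x 0 j ^+ 2 <= sqnorm x.
Proof.
move=> ij; rewrite sqnormE (bigD1 i)//= (bigD1 j) 1?eq_sym//= addrA.
by rewrite lerDl sumr_ge0// => k _; exact: sqr_ge0.
Qed.

Lemma approx_quadratic0 (R : realType) n (d : R) (D : 'rV[R]_n -> R) :
  approx_quadratic d D -> D 0 = 0.
Proof. by move=> [DZ _]; rewrite -(scale0r 0) DZ expr2 !mul0r. Qed.

(** The coordinates of x are added one at a time; an inner induction bounds the cost of each new
    one. *)
Lemma approx_quadratic_pairs (R : realType) n (d : R) (D : 'rV[R]_n -> R) :
  approx_quadratic d D ->
  (forall i, D (delta_mx 0 i) = 0) ->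
  (forall i j (s t : R), i != j ->
     `|D (s *: delta_mx 0 i + t *: delta_mx 0 j)| <= 3 * d * (s ^+ 2 + t ^+ 2)) ->
  forall x, `|D x| <= 3 * n%:R ^+ 2 * d * sqnorm x.
Proof.
move=> DA De Dpair x; have [DZ Dpar] := DA; have D0 := approx_quadratic0 DA.
have [n0|n0] := posnP n.
  by subst n; rewrite thinmx0 D0 normr0 expr2 mul0r mulr0 !mul0r.
have dx0 : 0 <= d * sqnorm x.
  by have := le_trans (normr_ge0 _) (Dpar x x); lra.
have d0 : 0 <= d.
  have := le_trans (normr_ge0 _) (Dpar (delta_mx 0 (Ordinal n0)) 0).
  by rewrite sqnorm_delta [sqnorm 0]sqnormE big1 => [|i _]; rewrite ?mxE ?expr2 ?mul0r//; lra.
pose y i : 'rV[R]_n := x 0 i *: delta_mx 0 i.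
have Dy i : D (y i) = 0 by rewrite /y DZ De mulr0.
have sqy i : sqnorm (y i) = x 0 i ^+ 2 by rewrite sqnormZ sqnorm_delta mulr1.
(* Each coordinate i below k costs at most 6 d |x|^2: 3 from the triple (prefix, y i, y j) and 3
   from the plane of y i and y j. *)
have cross (j : 'I_n) k : (k <= j)%N ->
    `|D (prefix_row k x + y j) - D (prefix_row k x)| <= 6 * k%:R * (d * sqnorm x).
  elim: k => [_|k IHk kj].
    by rewrite prefix_row0 add0r Dy D0 subrr normr0 mulr0 mul0r.
  have kn : (k < n)%N by apply: leq_trans (ltn_ord j); exact: ltnW.
  pose i := Ordinal kn; have ij : i != j by rewrite -(inj_eq val_inj) /= ltn_eqF.
  have := IHk (ltnW kj).
  have yij : bform 1%:M (y i) (y j) = 0.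
    by rewrite bformZl bformZr bform_delta mxE (negbTE ij) !mulr0.
  have := approx_quadratic_triple DA (bform_prefix_row x (x 0 i) (leqnn i))
            (bform_prefix_row x (x 0 j) (ltnW kj)) yij.
  have := Dpair i j (x 0 i) (x 0 j) ij.
  have := sqnorm_prefix_row x kj.
  rewrite -(prefix_rowS i) /= -/(y i) -/(y j) !Dy !sqy.
  rewrite -[k.+1]/(i.+1) prefix_rowS -/(y i) sqnormD sqy (bform_prefix_row _ _ (leqnn i)) /=.
  move=> sq1 pair triple IH.
  have {}sq1 := ler_wpM2l d0 sq1.
  have sq2 := ler_wpM2l d0 (sqnorm_coord2 x ij).
  move: pair triple IH; rewrite -[k.+1]addn1 natrD !ler_norml.
  by move=> /andP[? ?] /andP[? ?] /andP[? ?]; apply/andP; split; lra.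
(* The increments 6k add up within 3 k^2, since 3 k^2 + 6k <= 3 (k + 1)^2. *)
have prefix k : (k <= n)%N -> `|D (prefix_row k x)| <= 3 * k%:R ^+ 2 * (d * sqnorm x).
  elim: k => [_|k IHk kn].
    by rewrite prefix_row0 D0 normr0 expr2 mul0r mulr0 mul0r.
  have := IHk (ltnW kn); have := cross (Ordinal kn) k (leqnn k).
  rewrite -[k.+1]/((Ordinal kn).+1) prefix_rowS -/(y _) -[(Ordinal kn).+1]addn1 natrD /=.
  by rewrite !ler_norml => /andP[? ?] /andP[? ?]; apply/andP; split; lra.
by have := prefix n (leqnn n); rewrite prefix_row_size mulrA.
Qed.

(** A quadratic form obeys the parallelogram law exactly, so D = N - S has the same defect as N.
    Polarisation makes D vanish at each e i and agree at e k + e l and e k - e l, as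
    [approx_quadratic_plane] requires. *)
Lemma quadratic_stability (R : realType) n (d B : R) (N : 'rV[R]_n -> R) :
  approx_quadratic d N -> (forall x, `|N x| <= B * sqnorm x) ->
  exists2 S : 'M[R]_n, S^T = S &
    forall x, `|N x - bform S x x| <= 3 * n%:R ^+ 2 * d * sqnorm x.
Proof.
move=> NA NB; have [NZ Npar] := NA; have N0 := approx_quadratic0 NA.
pose e i : 'rV[R]_n := delta_mx 0 i.
pose S : 'M[R]_n := \matrix_(i, j) ((N (e i + e j) - N (e i - e j)) / 4).
have NN x : N (- x) = N x by rewrite -scaleN1r NZ sqrrN expr1n mul1r.
have sS : S^T = S.
  by apply/matrixP => i j; rewrite !mxE (addrC (e j)) -(NN (e j - e i)) opprB.
exists S => //; pose D x := N x - bform S x x.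
have DA : approx_quadratic d D.
  split=> [t x|a b]; first by (rewrite /D NZ bformZl bformZr; ring).
  rewrite (_ : D _ + _ - _ - _ = N (a + b) + N (a - b) - 2 * N a - 2 * N b)//.
  by rewrite /D !(bformDl, bformDr, bformNl, bformNr); ring.
have DZ := DA.1.
have Dei i : D (e i) = 0.
  by rewrite /D bform_delta mxE subrr N0 -mulr2n -scaler_nat NZ; field.
apply: (approx_quadratic_pairs DA) => //.
move=> i j s t ij.
have half k l : k != l -> forall t : R, `|t| <= 1 -> `|D (e k + t *: e l)| <= 3 * d.
  move=> kl.
  (* Any finite bound serves here. The term 2 |B| comes from 1 + u^2 <= 2, the rest from expanding S
     on e k + u e l. *)
  apply: (@approx_quadratic_plane R n d
    (2 * `|B| + (`|S k k| + 2 * `|S k l| + `|S l l|))) => //.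
  - by rewrite sqnorm_delta.
  - by rewrite sqnorm_delta.
  - by rewrite bform_delta mxE (negbTE kl).
  - rewrite /D !(bformDl, bformDr, bformNl, bformNr) !bform_delta.
    have -> : S l k = S k l by rewrite -[in LHS]sS mxE.
    by rewrite [S k l]mxE; field.
  - move=> u u1; rewrite /D.
    have E : bform S (e k + u *: e l) (e k + u *: e l) =
        S k k + 2 * (u * S k l) + u ^+ 2 * S l l.
      rewrite !(bformDl, bformDr, bformZl, bformZr) !bform_delta.
      have -> : S l k = S k l by rewrite -[in LHS]sS mxE.
      ring.
    have sq : sqnorm (e k + u *: e l) = 1 + u ^+ 2.
      rewrite sqnormD sqnormZ !sqnorm_delta bformZr bform_delta mxE (negbTE kl) /=.
      ring.
    have u2 : u ^+ 2 <= 1 by rewrite -real_normK ?num_real// expr_le1.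
    apply: le_trans (ler_normB _ _) _; rewrite lerD//.
      apply: le_trans (NB _) _; rewrite sq.
      have := ler_norm B; have := normr_ge0 B; have := sqr_ge0 u; nra.
    rewrite E; apply: le_trans (ler_normD _ _) _; rewrite lerD//.
      apply: le_trans (ler_normD _ _) _; rewrite lerD2l normrM ger0_norm// ler_wpM2l//.
      by rewrite normrM ler_piMl.
    by rewrite normrM ger0_norm ?sqr_ge0// ler_piMl.
by apply: approx_quadratic_span => //; apply: half; rewrite // eq_sym.
Qed.

(** * Orthonormal bases of positive definite forms *)

(** Induction by Schur complements: [L] clears the first row and column, leaving the pivot [a] and
    the complement [S']. The latter is S restricted to the vectors (0, y) L, hence positive
    definite. *)
Lemma posdef_congr1 (R : rcfType) n (S : 'M[R]_n) :
  S^T = S -> (forall x, x != 0 -> 0 < bform S x x) ->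
  exists2 T, T \in unitmx & T *m S *m T^T = 1%:M.
Proof.
elim: n S => [S _ _|n IHn S sS posS].
  by exists 1%:M; rewrite ?unitmx1// [LHS]flatmx0 [RHS]flatmx0.
move: S sS posS; rewrite -add1n => S sS posS.
pose a := S (lshift n 0) (lshift n 0).
pose b : 'rV_n := ursubmx S.
have aE : ulsubmx S = a%:M by apply/matrixP => i j; rewrite !ord1 !mxE.
have bE : dlsubmx S = b^T by rewrite trmx_ursub sS.
have SE : S = block_mx a%:M b b^T (drsubmx S) by rewrite -aE -bE submxK.
have a0 : 0 < a.
  rewrite /a -(bform_delta S); apply: posS; apply/eqP => /rowP/(_ (lshift n 0)).
  by rewrite !mxE !eqxx; apply/eqP; rewrite oner_eq0.
have aN0 := lt0r_neq0 a0.
pose L : 'M[R]_(1 + n) := block_mx 1%:M 0 (- a^-1 *: b^T) 1%:M.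
have Lu : L \in unitmx by rewrite unitmxE det_lblock !det1 mulr1 unitr1.
pose S' := drsubmx S - a^-1 *: (b^T *m b).
have LSL : L *m S *m L^T = block_mx a%:M 0 0 S'.
  rewrite SE /L tr_block_mx !trmx1 trmx0 !mulmx_block.
  rewrite !(mul1mx, mulmx1, mul0mx, mulmx0, addr0, add0r).
  rewrite linearZ /= trmxK.
  have -> : - a^-1 *: b^T *m a%:M + b^T = 0.
    by rewrite mul_mx_scalar scalerA mulrN divff// scaleN1r addNr.
  have -> : a%:M *m (- a^-1 *: b) + b = 0.
    by rewrite mul_scalar_mx scalerA mulrN divff// scaleN1r addNr.
  rewrite mul0mx add0r.
  by rewrite -scalemxAl scaleNr addrC.
have sS' : S'^T = S'.
  by rewrite /S' linearB /= linearZ /= trmx_mul trmxK trmx_drsub sS.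
have posS' y : y != 0 -> 0 < bform S' y y.
  move=> y0.
  have -> : bform S' y y = bform S (row_mx 0 y *m L) (row_mx 0 y *m L).
    rewrite bform_congr LSL /bform mul_row_block !mul0mx !mulmx0 !add0r.
    by rewrite tr_row_mx mul_row_col mul0mx add0r.
  apply: posS; apply: contra_neq y0 => /(congr1 (mulmx^~ (invmx L))).
  by rewrite mulmxK// mul0mx => /(congr1 rsubmx); rewrite row_mxKr linear0.
have [T' T'u T'E] := IHn S' sS' posS'.
have ra0 : Num.sqrt a != 0 by rewrite sqrtr_eq0 -ltNge.
pose M : 'M[R]_(1 + n) := block_mx (Num.sqrt a)^-1%:M 0 0 T'.
exists (M *m L).
  rewrite unitmx_mul Lu andbT unitmxE det_ublock det_scalar1 unitrM -unitmxE T'u.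
  by rewrite unitfE invr_eq0 ra0.
rewrite trmx_mul !mulmxA -(mulmxA M) -(mulmxA M) LSL.
rewrite /M tr_block_mx !trmx0 tr_scalar_mx !mulmx_block.
rewrite !(mulmx0, mul0mx, addr0, add0r) T'E -!scalar_mxM mulrAC -invfM -expr2 sqr_sqrtr ?ltW//.
by rewrite mulVf// -scalar_mx_block.
Qed.

(** In the coordinates of [P] the defect is at most 2 B e times the sum of the [sqnorm]s, so
    stability gives an error 6 n^2 B e |y|^2 <= eta N(y P). As eta < 1, S is positive definite, and
    a basis orthonormal for S is the new one. *)
Lemma improve_basis (R : realType) n (N : 'rV[R]_n -> R) (P : 'M[R]_n) (A B e : R) :
  (forall (t : R) x, N (t *: x) = t ^+ 2 * N x) -> (forall x, 0 <= N x) ->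
  (forall a b, `|N (a + b) + N (a - b) - 2 * N a - 2 * N b| <= 2 * e * (N a + N b)) ->
  P \in unitmx -> 0 <= A -> 0 <= B -> 0 <= e ->
  (forall y, sqnorm y <= A * N (y *m P)) -> (forall y, N (y *m P) <= B * sqnorm y) ->
  6 * n%:R ^+ 2 * A * B * e < 1 ->
  exists2 Q : 'M[R]_n, Q \in unitmx &
    forall y, (1 - 6 * n%:R ^+ 2 * A * B * e) * N (y *m Q) <= sqnorm y
              <= (1 + 6 * n%:R ^+ 2 * A * B * e) * N (y *m Q).
Proof.
move=> NZ N0 Npar Pu A0 B0 e0 NA NB; set eta := (_ * e) => eta1.
have NA' : approx_quadratic (2 * B * e) (fun y => N (y *m P)).
  split=> [t x|a b]; first by rewrite -scalemxAl NZ.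
  rewrite mulmxDl mulmxBl; apply: le_trans (Npar _ _) _.
  have := NB a; have := NB b; nra.
have NB' y : `|N (y *m P)| <= B * sqnorm y by rewrite ger0_norm.
have [S sS SN] := quadratic_stability NA' NB'.
have {}SN y : `|N (y *m P) - bform S y y| <= eta * N (y *m P).
  apply: le_trans (SN y) _.
  have := ler_wpM2l (mulr_ge0 (mulr_ge0 B0 e0) (sqr_ge0 (n%:R : R))) (NA y).
  by rewrite /eta; lra.
have bN y : (1 - eta) * N (y *m P) <= bform S y y <= (1 + eta) * N (y *m P).
  by have := SN y; rewrite ler_norml => /andP[? ?]; apply/andP; split; lra.
have posS y : y != 0 -> 0 < bform S y y.
  move=> y0; have /andP[+ _] := bN y; apply: lt_le_trans.
  have yp : 0 < sqnorm y.
    rewrite lt0r sqnorm_ge0 andbT; apply: contra_neq y0 => /eqP.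
    rewrite sqnormE psumr_eq0 => [/allP h|i _]; last exact: sqr_ge0.
    apply/rowP => i; rewrite mxE; apply/eqP.
    by have := h i (mem_index_enum i); rewrite /= sqrf_eq0.
  apply: mulr_gt0; first by rewrite subr_gt0.
  rewrite lt0r N0 andbT; apply/eqP => Ny.
  by have := NA y; rewrite Ny mulr0 leNgt yp.
have [T Tu TE] := posdef_congr1 sS posS.
exists (T *m P) => [|y]; first by rewrite unitmx_mul Tu.
by rewrite mulmxA /sqnorm -TE -bform_congr.
Qed.

(** * Norms on row vectors *)

(** A predicate on functions, since ['rV[R]_n] already carries the maximum norm, whose topology is
    used for compactness. *)
Definition is_norm {R : realType} {n : nat} (p : 'rV[R]_n -> R) :=
  [/\ forall x y : 'rV_n, p (x + y) <= p x + p y,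
      forall (t : R) (x : 'rV_n), p (t *: x) = `|t| * p x
    & forall x : 'rV_n, p x = 0 -> x = 0].

Lemma is_norm0 (R : realType) n (p : 'rV[R]_n -> R) : is_norm p -> p 0 = 0.
Proof. by move=> [_ pZ _]; rewrite -(scale0r 0) pZ normr0 mul0r. Qed.

Lemma is_norm_ge0 (R : realType) n (p : 'rV[R]_n -> R) x : is_norm p -> 0 <= p x.
Proof.
move=> pn; have [pD pZ _] := pn; have := pD x (- x).
rewrite subrr (is_norm0 pn) -scaleN1r pZ normrN normr1; lra.
Qed.

Lemma is_norm_sum (R : realType) n m (p : 'rV[R]_n -> R) (y : 'rV[R]_m) (A : 'M[R]_(m, n)) :
  is_norm p -> p (y *m A) <= \sum_i `|y 0 i| * p (row i A).
Proof.
move=> pn; have [pD pZ _] := pn; rewrite mulmx_sum_row.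
elim/big_ind2 : _ => [|u s v t pu pv|i _]; first by rewrite is_norm0.
  by apply: le_trans (pD _ _) _; exact: lerD.
by rewrite pZ.
Qed.

Lemma ler_coord_mx_norm (R : realType) n (x : 'rV[R]_n) i : `|x 0 i| <= `|x|.
Proof.
rewrite -[leRHS]/(mx_norm x) mx_normrE.
by apply/bigmax_geP; right; exists (0, i).
Qed.

Lemma is_norm_ubound (R : realType) n (p : 'rV[R]_n -> R) : is_norm p ->
  exists2 K, 0 <= K & forall x, p x <= K * `|x|.
Proof.
move=> pn; exists (\sum_i p (delta_mx 0 i)) => [|x].
  by apply: sumr_ge0 => i _; exact: is_norm_ge0.
rewrite -[x in p x]mulmx1; apply: le_trans (is_norm_sum _ _ pn) _.
rewrite mulr_suml ler_sum// => i _; rewrite row1 mulrC ler_wpM2l ?is_norm_ge0//.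
exact: ler_coord_mx_norm.
Qed.

Lemma lipschitz_fun_continuous (R : realType) (V : normedModType R) (f : V -> R) (K : R) :
  0 <= K -> (forall u v, f u - f v <= K * `|u - v|) -> continuous f.
Proof.
move=> K0 fK x; apply/cvgrPdist_le => /= e e0.
apply/nbhs_normP; exists (e / (K + 1)) => /=.
  by rewrite divr_gt0 // ltr_wpDl.
move=> y /= /ltW xy.
have : K * `|x - y| <= e.
  apply: (@le_trans _ _ (K * (e / (K + 1)))); first by rewrite ler_wpM2l.
  by rewrite mulrCA ler_piMr ?(ltW e0)// ler_pdivrMr ?ltr_wpDl// mul1r lerDl.
have := fK x y; have := fK y x; rewrite distrC => h1 h2 h3.
by rewrite ler_norml; apply/andP; split; lra.
Qed.

Lemma is_norm_continuous (R : realType) n (p : 'rV[R]_n -> R) :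
  is_norm p -> continuous p.
Proof.
move=> pn; have [pD _ _] := pn; have [K K0 pK] := is_norm_ubound pn.
apply: (lipschitz_fun_continuous K0) => u v; rewrite lerBlDr.
by apply: le_trans (lerD (pK _) (lexx _)); rewrite -{1}(subrK v u) pD.
Qed.

(** The continuous function p attains a positive minimum on the compact unit sphere of the maximum
    norm. *)
Lemma is_norm_lbound (R : realType) n (p : 'rV[R]_n -> R) : is_norm p ->
  exists2 c, 0 < c & forall x, c * `|x| <= p x.
Proof.
move=> pn; have [pD pZ p0] := pn.
pose A : set 'rV[R]_n := [set x | `|x| = 1].
(* An empty sphere means that 0 is the only vector, and any constant works. *)
have [A0|/set0P A0] := eqVneq A set0.
  exists 1 => // x; have [->|x0] := eqVneq x 0.
    by rewrite normr0 mulr0 is_norm_ge0.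
  suff : A (`|x|^-1 *: x) by rewrite A0.
  by rewrite /A /= normrZ normfV normr_id mulVf// normr_eq0.
have cA : compact A.
  apply: bounded_closed_compact.
    by exists 1; split; [rewrite num_real|move=> M M1 x /= ->; exact: ltW].
  apply: (@preimage_closed _ _ (fun x : 'rV[R]_n => `|x|) [set 1]).
    by move=> ? _; exact: norm_continuous.
  exact: closed_eq.
have [z] := EVT_min_rV A0 cA (continuous_subspaceT (is_norm_continuous pn)).
rewrite inE => zA zmin.
exists (p z) => [|x].
  rewrite lt0r is_norm_ge0// andbT; apply/eqP => /p0 z0.
  by move: zA; rewrite /A /= z0 normr0 => /esym/eqP; rewrite oner_eq0.
have [->|x0] := eqVneq x 0; first by rewrite normr0 mulr0 is_norm_ge0.
rewrite -ler_pdivlMr ?normr_gt0// mulrC -[X in X * _]ger0_norm ?invr_ge0// -pZ.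
by apply: zmin; rewrite inE /A /= normrZ normfV normr_id mulVf// normr_eq0.
Qed.

(** * Bases of nearly maximal determinant and their improvement *)

(** Cramer's rule in adjugate form: the cofactors along row i do not see row i. *)
Lemma det_row_replace (R : comNzRingType) n (P : 'M[R]_n) i (x : 'rV[R]_n) :
  \det (\matrix_(k, j) (if k == i then x 0 j else P k j)) = (x *m \adj P) 0 i.
Proof.
rewrite (expand_det_row _ i) mxE; apply: eq_bigr => j _; rewrite !mxE eqxx.
congr (_ * _); rewrite /cofactor; congr (_ * \det _).
by apply/matrixP => k l; rewrite !mxE eq_sym (negbTE (neq_lift _ _)).
Qed.

Lemma normr_det_le (R : numDomainType) n (P : 'M[R]_n) (c : R) :
  (forall i j, `|P i j| <= c) -> `|\det P| <= (n`!)%:R * c ^+ n.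
Proof.
move=> Pc; apply: le_trans (ler_norm_sum _ _ _) _.
apply: (@le_trans _ _ (\sum_(s : 'S_n) c ^+ n)).
  apply: ler_sum => s _; rewrite normrM normr_sign mul1r normr_prod.
  rewrite -[n in c ^+ n]card_ord -prodr_const.
  by apply: ler_prod => i _; rewrite normr_ge0 Pc.
by rewrite sumr_const card_Sn mulr_natl.
Qed.

(* The rows of P nearly maximise |det| among n-tuples of the unit ball; by
   Cramer's rule the coordinates of a unit vector in this basis are at most 2. *)
Lemma crude_basis (R : realType) n (p : 'rV[R]_n -> R) : is_norm p ->
  exists2 P : 'M[R]_n, P \in unitmx &
    forall y, sqnorm y <= 4 * n%:R * p (y *m P) ^+ 2 /\
              p (y *m P) ^+ 2 <= n%:R ^+ 2 * sqnorm y.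
Proof.
move=> pn; have [pD pZ p0] := pn; have [c c0 pc] := is_norm_lbound pn.
pose U : set 'M[R]_n := [set P | forall i, p (row i P) <= 1].
pose V : set R := [set `|\det P| | P in U].
have Vub : has_ubound V.
  exists ((n`!)%:R * c^-1 ^+ n) => _ [P PU <-]; apply: normr_det_le => i j.
  have := le_trans (pc _) (PU i); rewrite -ler_pdivlMl// mulr1.
  by apply: le_trans; have := ler_coord_mx_norm (row i P) j; rewrite mxE.
have [P0 P0U detP0] : exists2 P, U P & 0 < `|\det P|.
  have s0 : 0 < 1 + \sum_i p (delta_mx 0 i).
    by rewrite ltr_wpDr// sumr_ge0// => i _; exact: is_norm_ge0.
  exists ((1 + \sum_i p (delta_mx 0 i))^-1 *: 1%:M) => [i|].
    rewrite linearZ /= row1 pZ ger0_norm ?invr_ge0 ?(ltW s0)// ler_pdivrMl// mulr1.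
    rewrite (bigD1 i)//= addrCA lerDl addr_ge0// sumr_ge0// => j _.
    exact: is_norm_ge0.
  by rewrite detZ det1 mulr1 normr_gt0 expf_neq0// invr_neq0// lt0r_neq0.
have V0 : V !=set0 by exists `|\det P0|, P0.
have sV0 : 0 < sup V by apply: lt_le_trans detP0 _; apply: ub_le_sup => //; exists P0.
(* A maximiser up to a factor 2 suffices; this factor becomes the 4 in 4n. *)
have [_ [P PU <-] detP] := sup_adherent (divr_gt0 sV0 (ltr0n R 2)) (conj V0 Vub).
have {}detP : sup V < 2 * `|\det P| by lra.
have detP_gt0 : 0 < `|\det P| by lra.
exists P => [|y]; first by rewrite unitmxE unitfE -normr_gt0.
have yP i : `|y 0 i| <= 2 * p (y *m P).
  set x := y *m P; have [px0|px0] := eqVneq (p x) 0.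
    have : x *m invmx P = 0 by rewrite (p0 _ px0) mul0mx.
    rewrite /x mulmxK ?unitmxE ?unitfE -?normr_gt0// => ->.
    by rewrite mxE normr0 mulr_ge0 ?is_norm_ge0.
  have px : 0 < p x by rewrite lt0r px0 is_norm_ge0.
  (* Putting the normalised x in row i stays in [U] and multiplies |det P| by |y i| / p x, so this
     ratio is at most 2. *)
  pose Q := \matrix_(k, j) (if k == i then ((p x)^-1 *: x) 0 j else P k j).
  have QU : U Q.
    move=> k; have [->|ki] := eqVneq k i.
      have -> : row i Q = (p x)^-1 *: x by apply/rowP => j; rewrite [LHS]mxE [LHS]mxE eqxx.
      by rewrite pZ ger0_norm ?invr_ge0 ?(ltW px)// mulVf.
    have -> : row k Q = row k P by apply/rowP => j; rewrite [LHS]mxE [LHS]mxE (negbTE ki) mxE.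
    exact: PU.
  have : `|\det Q| <= sup V by apply: ub_le_sup => //; exists Q.
  rewrite det_row_replace -scalemxAl /x -mulmxA mul_mx_adj mul_mx_scalar -/x !mxE.
  rewrite !normrM ger0_norm ?invr_ge0 ?(ltW px)// ler_pdivrMl// => h.
  rewrite -(ler_pM2l detP_gt0); apply: le_trans h _.
  by have := ler_wpM2l (ltW px) (ltW detP); rewrite -/x; lra.
split.
  rewrite sqnormE; apply: (@le_trans _ _ (\sum_(i < n) 4 * p (y *m P) ^+ 2)).
    apply: ler_sum => i _; rewrite -real_normK ?num_real//.
    by have := yP i; have := normr_ge0 (y 0 i); nra.
  by rewrite sumr_const card_ord -mulr_natl; lra.
have r0 : 0 <= Num.sqrt (sqnorm y) by exact: sqrtr_ge0.
have pr : p (y *m P) <= n%:R * Num.sqrt (sqnorm y).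
  apply: le_trans (is_norm_sum _ _ pn) _.
  apply: (@le_trans _ _ (\sum_(i < n) Num.sqrt (sqnorm y))).
    apply: ler_sum => i _; apply: (@le_trans _ _ `|y 0 i|); first by rewrite ler_piMr.
    rewrite -sqrtr_sqr ler_wsqrtr// sqnormE (bigD1 i)//= lerDl sumr_ge0// => j _.
    exact: sqr_ge0.
  by rewrite sumr_const card_ord mulr_natl.
rewrite -[X in _ * X]sqr_sqrtr ?sqnorm_ge0// -exprMn ler_pXn2r// nnegrE ?is_norm_ge0//.
Qed.

(** The crude basis gives eta = 6 n^2 * 4n * n^2 * e = 24 n^5 e, and 192 = 8 * 24 makes it at most
    1/8. The second pass then starts from A = 1 + 1/8 and B = 1 / (1 - 1/8). *)
Lemma near_euclidean_basis (R : realType) n (p : 'rV[R]_n -> R) (e : R) :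
  is_norm p -> 0 <= e -> (0 < n)%N -> e < (192 * n%:R ^+ 5)^-1 ->
  (forall a b, `|p (a + b) ^+ 2 + p (a - b) ^+ 2 - 2 * p a ^+ 2 - 2 * p b ^+ 2|
     <= 2 * e * (p a ^+ 2 + p b ^+ 2)) ->
  exists2 Q : 'M[R]_n, Q \in unitmx &
    forall y, (1 - 54 / 7 * n%:R ^+ 2 * e) * p (y *m Q) ^+ 2 <= sqnorm y
              <= (1 + 54 / 7 * n%:R ^+ 2 * e) * p (y *m Q) ^+ 2.
Proof.
move=> pn e0 n0 eps par; have [pD pZ _] := pn.
have nn0 : 0 < n%:R :> R by rewrite ltr0n.
have NZ (t : R) x : p (t *: x) ^+ 2 = t ^+ 2 * p x ^+ 2.
  by rewrite pZ exprMn real_normK ?num_real.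
have eps8 : 24 * n%:R ^+ 5 * e < 1 / 8.
  by move: eps; rewrite -div1r ltr_pdivlMr ?mulr_gt0 ?exprn_gt0//; lra.
have [P Pu Pcrude] := crude_basis pn.
have [|Q1 Q1u Q1E] := improve_basis NZ (fun x => sqr_ge0 (p x)) par Pu
    (mulr_ge0 (ler0n R 4) (ltW nn0)) (sqr_ge0 n%:R) e0
    (fun y => (Pcrude y).1) (fun y => (Pcrude y).2).
  by lra.
set eta := 6 * _ * _ * _ * e in Q1E.
have eta8 : eta <= 1 / 8 by rewrite /eta; lra.
have eta0 : 0 <= eta by rewrite /eta !mulr_ge0// ltW.
have [|||y|y||Q Qu QE] :=
    @improve_basis _ _ (fun x => p x ^+ 2) Q1 (9 / 8) (8 / 7) e NZ
      (fun x => sqr_ge0 (p x)) par Q1u.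
- by lra.
- by lra.
- by [].
- by have /andP[_] := Q1E y; have := sqr_ge0 (p (y *m Q1)); nra.
- by have /andP[+ _] := Q1E y; have := sqr_ge0 (p (y *m Q1)); nra.
(* The second eta is at most 54/7 n^5 e, well below 1 under the same threshold. *)
- have : n%:R ^+ 2 * e <= n%:R ^+ 5 * e.
    by rewrite ler_wpM2r// ler_weXn2l// ler1n.
  by lra.
exists Q => // y; have -> : 54 / 7 * n%:R ^+ 2 * e = 6 * n%:R ^+ 2 * (9 / 8) * (8 / 7) * e.
  by field.
exact: QE.
Qed.

(** * Operator norms and the Banach-Mazur distance *)

Lemma op_norm_le (R : realType) (X Y : normedModType R) (f : {linear X -> Y}) (c : R) :
  0 <= c -> (forall x, `|f x| <= c * `|x|) -> (op_norm f <= c%:E)%E.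
Proof.
move=> c0 fc; apply: ge_ereal_sup => _ [x /= x1 <-]; rewrite lee_fin.
by apply: le_trans (fc x) _; rewrite ler_piMr.
Qed.

Lemma op_norm_ge0 (R : realType) (X Y : normedModType R) (f : {linear X -> Y}) :
  (0 <= op_norm f)%E.
Proof.
apply: ereal_sup_ubound; exists 0; first by rewrite /= normr0.
by rewrite linear0 normr0.
Qed.

Lemma banach_mazur_le (R : realType) (X : normedVectType R) (n : nat)
    (Q : 'M[R]_n) (phi : {linear X -> 'rV[R]_n}) (psi : {linear 'rV[R]_n -> X}) (a b : R) :
  cancel phi psi -> cancel psi phi -> Q \in unitmx -> 0 <= a -> 0 <= b ->
  (forall y, sqnorm y <= a ^+ 2 * `|psi (y *m Q)| ^+ 2) ->
  (forall y, `|psi (y *m Q)| ^+ 2 <= b ^+ 2 * sqnorm y) ->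
  (banach_mazur X (euclidean R n) <= (a * b)%:E)%E.
Proof.
move=> phiK psiK Qu a0 b0 ha hb.
pose L : {linear X -> euclidean R n} := mulmxr (invmx Q) \o phi.
pose Li : {linear euclidean R n -> X} := psi \o mulmxr Q.
have sqE (y : euclidean R n) : `|y| ^+ 2 = sqnorm y by rewrite sqnormE; exact: sqr_eucl_norm.
have LK : cancel L Li by move=> x /=; rewrite mulmxKV.
have LiK : cancel Li L by move=> y /=; rewrite psiK mulmxK.
apply: (@le_trans _ _ (op_norm L * op_norm Li)%E).
  by apply: ereal_inf_lbound; exists L, Li.
rewrite EFinM; apply: lee_pmul; rewrite ?op_norm_ge0//; apply: op_norm_le => // x.
  rewrite -ler_sqr ?nnegrE ?mulr_ge0// exprMn sqE.
  by apply: le_trans (ha _) _; rewrite /= mulmxKV// phiK.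
by rewrite -ler_sqr ?nnegrE ?mulr_ge0// exprMn sqE; exact: hb.
Qed.

Lemma vNJ_parallelogram (R : realType) (X : normedModType R) (e : R) (a b : X) :
  vNJ_bound X (e + 1) ->
  `| `|a + b| ^+ 2 + `|a - b| ^+ 2 - 2 * `|a| ^+ 2 - 2 * `|b| ^+ 2|
    <= 2 * e * (`|a| ^+ 2 + `|b| ^+ 2).
Proof.
move=> [/andP[e1 _] H]; have e0 : 0 <= e by lra.
(* The constant only constrains nonzero vectors; if one is zero the law is exact. *)
have [->|a0] := eqVneq a 0.
  rewrite add0r sub0r normrN normr0 [X in `|X|](_ : _ = 0); last by ring.
  by rewrite normr0 !mulr_ge0// addr_ge0 ?sqr_ge0.
have [->|b0] := eqVneq b 0.
  rewrite addr0 subr0 normr0 [X in `|X|](_ : _ = 0); last by ring.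
  by rewrite normr0 !mulr_ge0// addr_ge0 ?sqr_ge0.
have := H a b a0 b0.
have s0 : 0 < 2 * (`|a| ^+ 2 + `|b| ^+ 2).
  by rewrite mulr_gt0// addr_gt0// exprn_gt0// normr_gt0.
rewrite ler_pdivlMr// ler_pdivrMr// => /andP[lo hi].
(* This makes the lower deviation no larger than the upper one, e. *)
have inv : 1 - e <= 1 / (e + 1) by rewrite ler_pdivlMr; [nra|lra].
have := ler_wpM2r (ltW s0) inv.
by move=> ?; rewrite ler_norml; apply/andP; split; lra.
Qed.

Lemma banach_mazur_bound (R : realType) (X : normedVectType R) (n : nat) (e : R) :
  (0 < n)%N -> \dim {:X} = n -> is_vNJ_constant X (e + 1) -> e < (192 * n%:R ^+ 5)^-1 ->
  (banach_mazur X (euclidean R n) <= (1 + (18 * n%:R ^+ 2 - 17 * n%:R + 14) * e)%:E)%E.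
Proof.
rewrite dimvf => n0 dimX [vNJ _] eps; subst n.
have e0 : 0 <= e by have := vNJ.1; lra.
pose phi : {linear X -> 'rV[R]_(dim X)} := @v2r R X.
pose psi : {linear 'rV[R]_(dim X) -> X} := @r2v R X.
have phiK : cancel phi psi by exact: v2rK.
have psiK : cancel psi phi by exact: r2vK.
have pn : is_norm (fun x => `|psi x|).
  split=> [x y|t x|x /eqP]; first by rewrite linearD ler_normD.
    by rewrite linearZ normrZ.
  by rewrite normr_eq0 => /eqP/(congr1 phi); rewrite psiK linear0.
have [a b|Q Qu QE] := near_euclidean_basis pn e0 n0 eps.
  by rewrite linearD linearB; exact: vNJ_parallelogram.
set N : R := (dim X)%:R in eps QE *.
have N1 : 1 <= N by rewrite ler1n.
set eta := 54 / 7 * N ^+ 2 * e in QE.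
have eta0 : 0 <= eta by rewrite !mulr_ge0 ?sqr_ge0.
have eta8 : eta <= 1 / 8.
  have : N ^+ 2 * e <= N ^+ 5 * e by rewrite ler_wpM2r// ler_weXn2l.
  by move: eps; rewrite -div1r ltr_pdivlMr ?mulr_gt0 ?exprn_gt0//; rewrite /eta; lra.
apply: le_trans (banach_mazur_le (a := Num.sqrt (1 + eta)) (b := Num.sqrt (1 - eta)^-1)
  phiK psiK Qu _ _ _ _) _; rewrite ?sqrtr_ge0//.
- by move=> y; rewrite sqr_sqrtr ?addr_ge0//; have /andP[] := QE y.
- move=> y; rewrite sqr_sqrtr ?invr_ge0; last lra.
  by rewrite ler_pdivlMl; [have /andP[] := QE y|lra].
rewrite lee_fin -sqrtrM ?addr_ge0//.
have c0 : 0 <= (18 * N ^+ 2 - 17 * N + 14) * e by rewrite mulr_ge0//; nra.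
rewrite -[leRHS]ger0_norm ?addr_ge0// -sqrtr_sqr ler_wsqrtr// ler_pdivrMr; last lra.
(* 432/49 is 8/7 times 54/7, so this says eta <= 7/8 c. The quadratic 18 N^2 - 17 N + 14 - 432/49
   N^2 has negative discriminant. *)
have ce : 432 / 49 * N ^+ 2 * e <= (18 * N ^+ 2 - 17 * N + 14) * e.
  by rewrite ler_wpM2r//; nra.
set c := _ * e in c0 ce *.
(* As 1 - eta >= 7/8, (1 + c)^2 (1 - eta) >= 1 - eta + 7/4 c >= 1 + eta. *)
have : eta <= 7 / 8 * c by rewrite /eta; lra.
by nra.
Qed.

Theorem theorem1p2 (R : realType) (n : nat) (hn : (2 <= n)%N) :
  exists (eps_n : R) (K : R -> R),
    [/\ 0 < eps_n,
        K = (fun e : R => 1 + (18 * n%:R ^+ 2 - 17 * n%:R + 14) * e)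
            +O_ (within `[0, eps_n[ (nbhs (0 : R))) (fun e : R => e ^+ 2)
      & forall (X : normedVectType R) (e : R),
          \dim {:X} = n -> is_vNJ_constant X (e + 1) -> e < eps_n ->
          (banach_mazur X (euclidean R n) <= (K e)%:E)%E].
Proof.
have n0 : (0 < n)%N by exact: ltnW.
(* K is the affine function itself, so the O(e^2) remainder is zero. *)
exists (192 * n%:R ^+ 5)^-1, (fun e => 1 + (18 * n%:R ^+ 2 - 17 * n%:R + 14) * e).
split.
- by rewrite invr_gt0 mulr_gt0// exprn_gt0// ltr0n.
- apply/eqaddOP; exists 0; split; first exact: num_real.
  by move=> k k0; near=> e; rewrite /= subrr normr0 mulr_ge0 // ltW.
- by move=> X e dimX vNJ eps; exact: banach_mazur_bound.
Unshelve. all: by end_near. Qed.
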